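(* Let $\theta>0$, $h>0$ and $k\in\mathbb{N}$. The $k$th Poissonised Charlier factorial moment is related to the $k$th moment of the random variable $U+2\sqrt{Uh}\,\xi+h$ (where $\xi$ has the arcsine distribution on $(-1,1)$ and $U$ is uniform on $(0,1)$, independent of $\xi$) in the following way: $$\int_0^1\int_{-1}^1\left(u+2\sqrt{uh}\,s+h\right)^k\frac{\mathrm{d}s\,\mathrm{d}u}{\pi\sqrt{1-s^2}}=\frac{M^\theta(k;1/h)}{(\theta/h)^k}.$$
   Context: Conventions: $\mathbb{N}=\{0,1,2,\dots\}$; an empty product is $1$. The arcsine distribution on $(-1,1)$ has density $\frac{1}{\pi\sqrt{1-s^2}}$. Hypergeometric notation: $(a)_i=a(a+1)\cdots(a+i-1)$ and ${}_2F_0\left(\begin{matrix}a,b\\ -\end{matrix};z\right)=\sum_{i\ge0}(a)_i(b)_i\frac{z^i}{i!}$, which terminates if $a$ or $b$ is a nonpositive integer. For $\theta>0$, the Poisson measure is $\mu^{\theta}(x)=\theta^xe^{-\theta}/x!$, $x\in\mathbb{N}$. The normalised Charlier polynomials are $c_n(x;\theta)=\sqrt{\theta^n/n!}\;{}_2F_0\left(\begin{matrix}-n,-x\\ -\end{matrix};-\frac1\theta\right)$, $n\in\mathbb{N}$. The Charlier one-point function with $N\ge1$ particles is the probability mass function on $\mathbb{N}$ given by $\rho_N^{\theta}(x)=\frac1N\sum_{n=0}^{N-1}c_n(x;\theta)^2\mu^\theta(x)$. The Poissonised Charlier factorial moment is, for $t>0$, $$M^\theta(k;t)=\sum_{m\ge0}e^{-t\theta}\frac{(t\theta)^m}{m!}\sum_{x\ge0}x(x-1)\cdots(x-k+1)\,\rho_{m+1}^\theta(x).$$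 *)

(* Defs.v *)
From HB Require Import structures.
From mathcomp Require Import all_boot all_order all_algebra.
From mathcomp Require Import all_classical all_reals all_analysis.

Set Implicit Arguments.
Unset Strict Implicit.
Unset Printing Implicit Defensive.

Import Order.TTheory GRing.Theory Num.Theory.
Import numFieldNormedType.Exports.

Local Open Scope classical_set_scope.
Local Open Scope ring_scope.

Definition pochhammer (R : realType) (a : R) (i : nat) : R :=
  \prod_(j < i) (a + j%:R).

(* [limn] returns an unspecified value on a divergent sequence, so this is only
   meaningful when the series converges; when a or b is a nonpositive integer
   the terms eventually vanish. *)
Definition hypergeom_2F0 (R : realType) (a b z : R) : R :=
  limn (series (fun i => pochhammer a i * pochhammer b i * (z ^+ i / i`!%:R))).

Definition charlier (R : realType) (theta : R) (n x : nat) : R :=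
  Num.sqrt (theta ^+ n / n`!%:R) *
  hypergeom_2F0 (- n%:R) (- x%:R) (- theta^-1).

(* For theta <= 0, [poisson_pmf theta] takes the junk value 1; it is used here
   only for positive rates. *)
Definition charlier_one_point (R : realType) (theta : R) (N x : nat) : R :=
  N%:R^-1 * \sum_(n < N) charlier theta n x ^+ 2 * poisson_pmf theta x.

(* All terms are nonnegative, so the sums make sense in \bar R;
   x ^_ k is the falling factorial x (x - 1) ... (x - k + 1). *)
Definition poissonised_charlier_factorial_moment (R : realType)
    (theta : R) (k : nat) (t : R) : \bar R :=
  (\sum_(0 <= m <oo) (poisson_pmf (t * theta) m)%:E *
     \sum_(0 <= x <oo) ((x ^_ k)%:R * charlier_one_point theta m.+1 x)%:E)%E.

Definition arcsine_pdf (R : realType) (s : R) : R :=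
  (pi * Num.sqrt (1 - s ^+ 2))^-1.

Definition arcsine_distributed (d : measure_display) (T : measurableType d)
    (R : realType) (P : probability T R) (X : {RV P >-> R}) : Prop :=
  forall A : set R, measurable A ->
    distribution P X A =
    (\int[lebesgue_measure]_(s in A `&` `](-1)%R, 1%R[) (arcsine_pdf s)%:E)%E.

Definition uniform01_distributed (d : measure_display) (T : measurableType d)
    (R : realType) (P : probability T R) (X : {RV P >-> R}) : Prop :=
  forall A : set R, measurable A ->
    distribution P X A = uniform_prob (@ltr01 R) A.

Definition independent_RV2 (d : measure_display) (T : measurableType d)
    (R : realType) (P : probability T R) (X Y : {RV P >-> R}) : Prop :=
  forall A B : set R, measurable A -> measurable B ->
    P (X @^-1` A `&` Y @^-1` B) = (P (X @^-1` A) * P (Y @^-1` B))%E.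

(* Main.v *)
Require Import Defs.
From HB Require Import structures.
From mathcomp Require Import all_boot all_order all_algebra.
From mathcomp Require Import all_classical all_reals all_analysis.
From mathcomp Require Import measurable_realfun ring lra zify.
Import Order.TTheory GRing.Theory Num.Theory.
Import numFieldNormedType.Exports.
Local Open Scope classical_set_scope.
Local Open Scope ring_scope.

(** Both sides equal [\sum_i 'C(k, i)^2 h^(k - i) / (i + 1)].

    Moment side: E f(x) under the Poisson law turns x f(x - 1) into theta E f,
    and C_{n+1}(x) = C_n(x) - (x / theta) C_n(x - 1) for the unnormalised
    Charlier polynomials, so orthogonality follows by induction.  Expanding
    C_n(x + k) in C_{n-i}(x) then shows that the k-th factorial moment of
    c_n^2 mu is \sum_i 'C(k, i)^2 theta^(k - i) n^_i.  Averaging over n <= m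
    replaces n^_i by m^_i / (i + 1), and m^_i has Poisson mean (t theta)^i.

    Integral side: the substitution s = sin x turns the arcsine law into the
    uniform law on (-pi/2, pi/2).  With the resulting moments, the inner
    integral is the coefficient of 'X^k in ('X^2 + (u + h) 'X + u h)^k, which
    factors as ('X + u)^k ('X + h)^k. *)

(** * Sums of binomial coefficients and falling factorials *)

(** Pascal's rule under the sum sign, in the form used by the inductions that expand Charlier
    polynomials. *)
Lemma sum_binS {R : nzRingType} (n N : nat) (a : nat -> R) :
  \sum_(j < N.+1) 'C(n.+1, j)%:R * a j =
  \sum_(j < N.+1) 'C(n, j)%:R * a j + \sum_(j < N) 'C(n, j)%:R * a j.+1.
Proof.
rewrite !big_ord_recl /= !bin0 -addrA -big_split /=; congr (_ + _).
by apply: eq_bigr => j _; rewrite /bump /= add1n binS natrD mulrDl.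
Qed.

(** Falling factorials telescope, so both sides equal (m+1)^_(i+1); the denominator i + 1 is
    multiplied out to stay in [nat]. *)
Lemma sum_ffact (m i : nat) :
  ((\sum_(n < m.+1) n ^_ i) * i.+1 = m.+1 * m ^_ i)%N.
Proof.
rewrite -ffactnS; elim: m => [|m IH].
  by rewrite big_ord1 ffactnS; case: i => [|i]; rewrite ?ffact0n ?muln0.
rewrite big_ord_recr /= mulnDl IH [RHS]ffactnS ffactnSr.
have [im|im] := leqP i m.+1; last by rewrite !ffact_small// ?ltnW// !muln0.
by rewrite [X in (_ + X)%N]mulnC (mulnC _ (m.+1 - i)%N) -mulnDl addnS subnK.
Qed.

Lemma eq_cvgn {T : topologicalType} (f g : nat -> T) (l : T) :
  g =1 f -> f @ \oo --> l -> g @ \oo --> l.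
Proof. by move=> /funext ->. Qed.

(** * Poisson means and Charlier polynomials *)

Section poisson_mean.
Context {R : realType} (theta : R) (theta_gt0 : 0 < theta).

(** Ordinary convergence of a real series: signed functions are allowed, and existence of the mean
    is carried along with its value. *)
Definition has_poisson_mean (f : nat -> R) (v : R) :=
  series (fun x => f x * poisson_pmf theta x) @ \oo --> v.

Lemma has_poisson_mean_lin (c d : R) f g v w :
  has_poisson_mean f v -> has_poisson_mean g w ->
  has_poisson_mean (fun x => c * f x + d * g x) (c * v + d * w).
Proof.
move=> fv gw; apply: (@eq_cvgn _ (fun n =>
    c * series (fun x => f x * poisson_pmf theta x) n +
    d * series (fun x => g x * poisson_pmf theta x) n)); last first.
  by apply: cvgD; exact: cvgMl_tmp.
move=> n; rewrite /series /= !mulr_sumr -big_split /=.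
by apply: eq_bigr => i _; ring.
Qed.

Lemma has_poisson_mean_sum (I : Type) (r : seq I) (c : I -> R)
    (F : I -> nat -> R) (V : I -> R) :
  (forall i, has_poisson_mean (F i) (V i)) ->
  has_poisson_mean (fun x => \sum_(i <- r) c i * F i x)
    (\sum_(i <- r) c i * V i).
Proof.
move=> FV; elim: r => [|i r IH].
  rewrite big_nil; apply: (@eq_cvgn _ (fun=> 0)); last exact: cvg_cst.
  by move=> n; rewrite /series /= big1// => x _; rewrite big_nil mul0r.
rewrite big_cons -[\sum_(_ <- _) _]mul1r.
under eq_fun do rewrite big_cons -[\sum_(_ <- _) _]mul1r.
exact: has_poisson_mean_lin.
Qed.

Lemma has_poisson_mean1 : has_poisson_mean (fun=> 1) 1.
Proof.
rewrite /has_poisson_mean -[X in _ --> X](expRxMexpNx_1 theta) mulrC.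
apply: (@eq_cvgn _ (fun n =>
    expR (- theta) * series (exp_coeff theta) n)); last first.
  by apply: cvgMl_tmp; exact: is_cvg_series_exp_coeff.
move=> n; rewrite /series /= mulr_sumr; apply: eq_bigr => i _.
by rewrite mul1r /poisson_pmf theta_gt0 mulrC.
Qed.

(** Since x theta^x / x! = theta theta^(x-1) / (x-1)!, reindexing absorbs the factor x. The term at
    0 vanishes, so [0.-1 = 0] does no harm. *)
Lemma has_poisson_mean_shift f v : has_poisson_mean f v ->
  has_poisson_mean (fun x => x%:R * f x.-1) (theta * v).
Proof.
move=> fv; rewrite /has_poisson_mean -cvg_shiftS.
apply: (@eq_cvgn _ (fun n => theta *
    series (fun x => f x * poisson_pmf theta x) n)); last exact: cvgMl_tmp.
move=> n; rewrite /series /= big_nat_recl//= !mul0r add0r mulr_sumr.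
apply: eq_bigr => i _; rewrite /poisson_pmf theta_gt0 exprS factS natrM.
by field; rewrite nat1r !pnatr_eq0 -lt0n fact_gt0.
Qed.

Lemma has_poisson_mean_ffact k f v : has_poisson_mean f v ->
  has_poisson_mean (fun x => (x ^_ k)%:R * f (x - k)%N) (theta ^+ k * v).
Proof.
elim: k f v => [|k IH] f v fv.
  rewrite mul1r; move: fv; congr has_poisson_mean.
  by apply/funext => x; rewrite ffactn0 mul1r subn0.
have := has_poisson_mean_shift _ _ (IH _ _ fv); rewrite mulrA -exprS.
congr has_poisson_mean; apply/funext => x.
by rewrite mulrA -natrM -ffactnS; congr (_ * f _); case: x.
Qed.

Lemma eseries_poisson_mean f v : has_poisson_mean f v ->
  (\sum_(0 <= x <oo) (f x * poisson_pmf theta x)%:E = v%:E)%E.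
Proof.
move=> fv; apply/cvg_lim => //.
apply: cvg_EFin; first by apply: nearW => n; rewrite sumEFin.
by apply: eq_cvgn fv => n; rewrite /= sumEFin.
Qed.

(** The 2F0 factor of the Charlier polynomial, given by a recurrence in n. At x = 0 the factor x
    kills the term with the truncated [x.-1]. *)
Fixpoint charlier_poly (n x : nat) : R :=
  if n is n'.+1 then charlier_poly n' x - x%:R / theta * charlier_poly n' x.-1
  else 1.

(** Pascal's rule matches the recurrence, because x (x-1)^_j = x^_(j+1). Any bound N above n is
    allowed, so that long partial sums of the hypergeometric series can be recognised. *)
Lemma charlier_poly_closed n x N : (n < N)%N ->
  charlier_poly n x =
  \sum_(j < N) 'C(n, j)%:R * ((x ^_ j)%:R * (- theta^-1) ^+ j).
Proof.
elim: n x N => [|n IH] x [//|N] nN.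
  rewrite big_ord_recl big1 ?addr0 /=; first by rewrite bin0 ffactn0 !mul1r.
  by move=> j _; rewrite bin0n /= mul0r.
rewrite (sum_binS n N (fun j => (x ^_ j)%:R * (- theta^-1) ^+ j)) /=.
rewrite -IH; last exact: ltnW.
congr (_ + _); rewrite (IH _ N)// mulr_sumr -sumrN; apply: eq_bigr => j _.
by rewrite ffactnS exprS natrM; ring.
Qed.

(** The forward difference in x lowers the degree, by induction along the recurrence in n. At n = 0
    the coefficient n / theta hides the truncated [n.-1]. *)
Lemma charlier_poly_succ n x :
  charlier_poly n x.+1 =
  charlier_poly n x - n%:R / theta * charlier_poly n.-1 x.
Proof.
have th0 : theta != 0 by rewrite gt_eqF.
elim: n x => [|n IH] x; first by rewrite /= !mul0r subr0.
rewrite /= IH; case: n IH => [|n] IH /=.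
  by rewrite -natr1 /=; field.
case: x => [|x] /=.
  by field.
by have := IH x; rewrite /= => /(canRL (subrK _)) ->; field.
Qed.

(** Iterating the difference relation k times gives a binomial expansion. For i > n the factor
    [n ^_ i] is 0. *)
Lemma charlier_poly_addn n x k N : (k < N)%N ->
  charlier_poly n (x + k) =
  \sum_(i < N) 'C(k, i)%:R * ((n ^_ i)%:R * (- theta^-1) ^+ i *
    charlier_poly (n - i) x).
Proof.
elim: k x N => [|k IH] x [//|N] kN.
  rewrite big_ord_recl big1 ?addr0 /=.
    by rewrite bin0 ffactn0 subn0 addn0 !mul1r.
  by move=> j _; rewrite bin0n /= mul0r.
rewrite (sum_binS k N (fun i => (n ^_ i)%:R * (- theta^-1) ^+ i *
  charlier_poly (n - i) x)) addnS -addSn (IH _ N.+1) 1?ltnW//.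
rewrite (eq_bigr (fun i : 'I_N.+1 =>
    'C(k, i)%:R * ((n ^_ i)%:R * (- theta^-1) ^+ i * charlier_poly (n - i) x) +
    'C(k, i)%:R * ((n ^_ i.+1)%:R * (- theta^-1) ^+ i.+1 *
      charlier_poly (n - i.+1) x))).
  rewrite big_split /=; congr (_ + _).
  by rewrite big_ord_recr /= bin_small// mul0r addr0.
move=> i _; rewrite charlier_poly_succ -mulrDr; congr (_ * _).
rewrite -subnS ffactnSr natrM exprS; ring.
Qed.

(** With E the Poisson mean, the shift rule gives E[C_{n+1} C_m] = E[C_n C_m] - E[C_n(x) C_m(x+1)],
    and the difference relation turns this into (m / theta) E[C_n C_{m-1}]. *)
Lemma charlier_poly_orthogonal n m :
  has_poisson_mean (fun x => charlier_poly n x * charlier_poly m x)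
    ((n == m)%:R * (n`!%:R / theta ^+ n)).
Proof.
have th0 : theta != 0 by rewrite gt_eqF.
elim: n m => [|n IH] m.
  rewrite divr1 mulr1.
  suff : has_poisson_mean (charlier_poly m) (0%N == m)%:R.
    by congr has_poisson_mean; apply/funext => x; rewrite mul1r.
  (* Past m = 0 the mean vanishes: E[C_{m+1}] = E[C_m] - E[C_m]. *)
  elim: m => [|m IHm]; first exact: has_poisson_mean1.
  have := has_poisson_mean_lin 1 (- theta^-1) _ _ _ _ IHm
    (has_poisson_mean_shift _ _ IHm).
  rewrite mul1r mulrA mulNr mulVf// mulN1r subrr; congr has_poisson_mean.
  by apply/funext => x /=; field.
have shift : has_poisson_mean
    (fun x => charlier_poly n x * charlier_poly m x.+1)
    ((n == m)%:R * (n`!%:R / theta ^+ n) -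
     m%:R / theta * ((n == m.-1)%:R * (n`!%:R / theta ^+ n))).
  have := has_poisson_mean_lin 1 (- (m%:R / theta)) _ _ _ _ (IH m) (IH m.-1).
  rewrite mul1r mulNr; congr has_poisson_mean.
  by apply/funext => x; rewrite charlier_poly_succ; ring.
have := has_poisson_mean_lin 1 (- theta^-1) _ _ _ _ (IH m)
  (has_poisson_mean_shift _ _ shift).
have -> : (n.+1 == m)%:R * (n.+1`!%:R / theta ^+ n.+1) =
    1 * ((n == m)%:R * (n`!%:R / theta ^+ n)) + - theta^-1 * (theta *
    ((n == m)%:R * (n`!%:R / theta ^+ n) -
     m%:R / theta * ((n == m.-1)%:R * (n`!%:R / theta ^+ n)))) :> R.
  have thn0 : theta ^+ n != 0 by rewrite expf_neq0.
  case: m {shift} => [|m] /=; first by rewrite !mul0r; field; rewrite th0 thn0.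
  rewrite eqSS; case: eqP => [->|_]; last first.
    by rewrite !mul0r mulr0 subr0; field; rewrite th0 thn0.
  by rewrite !mulr1n exprS factS natrM; field; rewrite th0 expf_neq0.
(* The point 0 is treated apart because [x.-1.+1] is x only away from 0. *)
congr has_poisson_mean; apply/funext => -[|x] /=; first by rewrite !mul0r; ring.
by ring.
Qed.

(** The factor x^_k turns the mean into theta^k E[C_n(x + k)^2]. Once both factors are expanded in
    the C_{n-i}(x), orthogonality leaves only the diagonal. *)
Lemma charlier_poly_factorial_moment n k :
  has_poisson_mean (fun x => (x ^_ k)%:R * charlier_poly n x ^+ 2)
    (n`!%:R / theta ^+ n *
     \sum_(i < k.+1) 'C(k, i)%:R ^+ 2 * (n ^_ i)%:R * theta ^+ (k - i)).
Proof.
have th0 m : theta ^+ m != 0 by rewrite expf_neq0// gt_eqF.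
pose a i : R := 'C(k, i)%:R * ((n ^_ i)%:R * (- theta^-1) ^+ i).
pose V i j : R := (n - i == n - j)%N%:R * ((n - i)`!%:R / theta ^+ (n - i)).
have := has_poisson_mean_sum _ (index_enum 'I_k.+1) (fun i => a i) _ _
  (fun i => has_poisson_mean_sum _ (index_enum 'I_k.+1) (fun j => a j) _ _
    (fun j => charlier_poly_orthogonal (n - i) (n - j))).
move=> /(has_poisson_mean_ffact k).
set v := (X in has_poisson_mean _ X); set w := (X in _ -> has_poisson_mean _ X).
have -> : v = w.
  rewrite /v /w !mulr_sumr; apply: eq_bigr => i _.
  (* Past n the truncated [n - i] is always 0, so distinct indices would collide; but there the
     coefficient contains n^_i = 0. The same holds for j below. *)
  have [ni|ni] := ltnP n i; first by rewrite /a ffact_small// !(mulr0, mul0r).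
  rewrite (bigD1 i)//= eqxx big1 ?addr0.
    rewrite mul1r /a -(ffact_fact ni) natrM.
    have -> : theta ^+ k = theta ^+ (k - i) * theta ^+ i :> R.
      by rewrite -exprD subnK// -ltnS.
    have -> : theta ^+ n = theta ^+ (n - i) * theta ^+ i :> R.
      by rewrite -exprD subnK.
    (* The sign occurs twice, so it is isolated as [e] with square 1; the rest is a field
       identity. *)
    rewrite exprNn exprVn; set e := (-1) ^+ i.
    have e2 : e * e = 1 by rewrite -expr2 /e sqrr_sign.
    transitivity (e * e * ('C(k, i)%:R ^+ 2 * (n ^_ i)%:R ^+ 2 *
      theta ^+ (k - i) * (n - i)`!%:R / (theta ^+ (n - i) * theta ^+ i))).
      by field; rewrite !th0.
    by rewrite e2 mul1r; field; rewrite !th0.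
  move=> j ji; have [nj|nj] := ltnP n j.
    by rewrite /a [n ^_ j]ffact_small// !(mulr0, mul0r).
  suff -> : (n - i == n - j)%N = false by rewrite mul0r mulr0.
  by apply/negbTE; apply: contra ji => /eqP; rewrite -val_eqE /=; lia.
congr has_poisson_mean; apply/funext => x.
(* Below k both sides vanish; from k on, x is written as (x - k) + k. *)
have [xk|kx] := ltnP x k; first by rewrite ffact_small// !mul0r.
congr (_ * _); rewrite -[in RHS](subnK kx) (charlier_poly_addn n _ k k.+1)//.
rewrite expr2 mulr_suml; apply: eq_bigr => i _.
rewrite !mulr_sumr; apply: eq_bigr => j _; rewrite /a; ring.
Qed.

(** The partial sums of the 2F0 series are constant from n + 1 terms on, so the [limn] in the
    definition is a genuine limit. *)
Lemma charlierE n x :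
  charlier theta n x = Num.sqrt (theta ^+ n / n`!%:R) * charlier_poly n x.
Proof.
congr (_ * _); apply/cvg_lim => //; rewrite -(cvg_shiftn n.+1).
apply: (@eq_cvgn _ (fun=> charlier_poly n x)); last exact: cvg_cst.
move=> N; rewrite (charlier_poly_closed n x (N + n.+1)) ?leq_addl//.
rewrite /series /= big_mkord; apply: eq_bigr => j _.
have pochN m : pochhammer (- m%:R : R) j = (-1) ^+ j * (m ^_ j)%:R.
  rewrite /pochhammer; elim: (nat_of_ord j) => [|i IH].
    by rewrite big_ord0 expr0 mul1r.
  rewrite big_ord_recr /= IH ffactnSr natrM exprS.
  have [im|mi] := leqP i m; first by rewrite natrB//; ring.
  by rewrite ffact_small//; ring.
rewrite !pochN -(bin_ffact n j) natrM.
have jf0 : j`!%:R != 0 :> R by rewrite pnatr_eq0 -lt0n fact_gt0.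
(* The signs of the two Pochhammer symbols cancel. *)
have <- : (-1) ^+ j * (-1) ^+ j *
    ('C(n, j)%:R * ((x ^_ j)%:R * (- theta^-1) ^+ j)) =
    'C(n, j)%:R * ((x ^_ j)%:R * (- theta^-1) ^+ j) :> R.
  by rewrite -expr2 sqrr_sign mul1r.
by field.
Qed.

(** The squared normalisation cancels the norm n! / theta^n; after the two finite sums are
    exchanged, [sum_ffact] averages n^_i over n <= m. *)
Lemma charlier_one_point_factorial_moment m k :
  (\sum_(0 <= x <oo) ((x ^_ k)%:R * charlier_one_point theta m.+1 x)%:E =
   (\sum_(i < k.+1) 'C(k, i)%:R ^+ 2 * theta ^+ (k - i) / i.+1%:R *
      (m ^_ i)%:R)%:E)%E.
Proof.
have := has_poisson_mean_sum _ (index_enum 'I_m.+1)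
  (fun n => m.+1%:R^-1 * (theta ^+ n / n`!%:R)) _ _
  (fun n => charlier_poly_factorial_moment n k).
move=> /eseries_poisson_mean; set v := (X in _ = X%:E -> _).
set w := (X in _ -> _ = X%:E).
have -> : v = w.
  rewrite /v /w.
  under eq_bigr => n _.
    rewrite mulrA (_ : _ * (n`!%:R / theta ^+ n) = m.+1%:R^-1); last first.
      have ? : n`!%:R != 0 :> R by rewrite pnatr_eq0 -lt0n fact_gt0.
      have ? : theta ^+ n != 0 :> R by rewrite expf_neq0// gt_eqF.
      by field; apply/and3P.
    over.
  rewrite -mulr_sumr exchange_big /= mulr_sumr; apply: eq_bigr => i _.
  rewrite -mulr_suml -mulr_sumr -natr_sum.
  have := sum_ffact m i => /(congr1 (fun x => x%:R : R)); rewrite !natrM.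
  move/(canRL (mulfK _)) => ->; last by rewrite pnatr_eq0.
  by field; rewrite !nat1r !pnatr_eq0.
move=> <-; apply: eq_eseriesr => x _; congr EFin.
rewrite /charlier_one_point mulr_suml !mulr_sumr; apply: eq_bigr => n _.
rewrite charlierE exprMn sqr_sqrtr; first by ring.
by rewrite divr_ge0// exprn_ge0// ltW.
Qed.

End poisson_mean.

(** The inner sum is a combination of the m^_i, whose Poisson means at rate t theta come from
    shifting the constant 1. *)
Lemma poissonised_charlier_factorial_momentE {R : realType} (theta t : R) k :
  0 < theta -> 0 < t ->
  poissonised_charlier_factorial_moment theta k t =
  (\sum_(i < k.+1) 'C(k, i)%:R ^+ 2 * theta ^+ (k - i) / i.+1%:R *
     (t * theta) ^+ i)%:E.
Proof.
move=> th0 t0; have tth0 : 0 < t * theta by rewrite mulr_gt0.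
have ff i :
    has_poisson_mean (t * theta) (fun x => (x ^_ i)%:R) ((t * theta) ^+ i).
  have := has_poisson_mean_ffact _ tth0 i _ _ (has_poisson_mean1 _ tth0).
  rewrite mulr1; congr has_poisson_mean.
  by apply/funext => x; rewrite mulr1.
rewrite -(eseries_poisson_mean _ _ _
  (has_poisson_mean_sum _ _ (index_enum 'I_k.+1) _ _ _ (fun i => ff i))).
apply: eq_eseriesr => m _.
by rewrite charlier_one_point_factorial_moment// -EFinM mulrC.
Qed.

(** * The substitution s = sin x in arcsine integrals *)

Section arcsine_moments.
Context {R : realType}.
Local Notation mu := (@lebesgue_measure R).

(* [arcsine_pdf] is unbounded near -1 and 1, so the substitution is made on the
   segments [`[- phi n, phi n]], which exhaust [`]- (pi / 2), pi / 2[]. *)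
Let phi (n : nat) : R := pi / 2 * (1 - n.+1%:R^-1).

Let phi_bound n : 0 <= phi n < pi / 2.
Proof.
have pi0 : 0 < pi / 2 :> R by rewrite divr_gt0// pi_gt0.
rewrite /phi mulr_ge0 ?(ltW pi0)//=.
  by rewrite -[ltRHS]mulr1 ltr_pM2l// gtrBl invr_gt0.
by rewrite subr_ge0 invf_le1// ler1n.
Qed.

Let phi_homo m n : (m <= n)%N -> phi m <= phi n.
Proof.
move=> mn; rewrite ler_pM2l ?divr_gt0 ?pi_gt0//.
by rewrite lerB// lef_pV2 ?posrE// ler_nat ltnS.
Qed.

Let phi_exhaust (x : R) : - (pi / 2) < x < pi / 2 ->
  exists n, - phi n <= x <= phi n.
Proof.
rewrite -ltr_norml => xpi.
have pi0 : 0 < pi / 2 :> R by rewrite divr_gt0// pi_gt0.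
have e0 : 0 < 1 - `|x| / (pi / 2) by rewrite subr_gt0 ltr_pdivrMr// mul1r.
(* |x| <= [phi n] amounts to 1 / (n + 1) <= 1 - |x| / (pi / 2), so n is the integer part of the
   inverse of the right-hand side. *)
exists (Num.truncn (1 - `|x| / (pi / 2))^-1); rewrite -ler_norml.
rewrite /phi -ler_pdivrMl// mulrC lerBrDl -lerBrDr.
rewrite invf_ple ?posrE ?ltW//; exact: truncnS_gt.
Qed.

Lemma sin_itv_bound (x : R) : - (pi / 2) < x < pi / 2 -> -1 < sin x < 1.
Proof.
have pi0 : 0 < pi / 2 :> R by rewrite divr_gt0// pi_gt0.
move=> /andP[x1 x2]; rewrite -sin_pihalf -sinN !ltr_sin ?x1//;
  rewrite in_itv/= ?lexx ?(ltW x1) ?(ltW x2) //= ?andbT; lra.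
Qed.

Let phi_itv n x :
  x \in `[- phi n, phi n]%R -> x \in `](- (pi / 2)), (pi / 2)[%R.
Proof.
have /andP[_ h] := phi_bound n; rewrite !in_itv/= => /andP[x1 x2].
by rewrite (le_lt_trans x2 h) (lt_le_trans _ x1)// ltrN2.
Qed.

Lemma continuous_arcsine_pdf (s : R) : -1 < s < 1 ->
  {for s, continuous (@arcsine_pdf R)}.
Proof.
move=> s1; have s2 : 0 < 1 - s ^+ 2.
  by rewrite subr_gt0 -real_normK ?num_real// expr_lt1// ltr_norml.
apply: cvgV; first by rewrite mulf_neq0 ?gt_eqF ?pi_gt0// sqrtr_gt0.
apply: cvgMl_tmp; apply: continuous_comp; last exact: sqrt_continuous.
by apply: cvgB; [exact: cvg_cst|exact: exprn_continuous].
Qed.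

Lemma arcsine_pdf_ge0 (s : R) : 0 <= arcsine_pdf s.
Proof. by rewrite invr_ge0 mulr_ge0 ?pi_ge0. Qed.

(** Here cos is positive, hence equal to sqrt (1 - sin^2): density times Jacobian is constant. *)
Lemma arcsine_pdf_sin (x : R) : - (pi / 2) < x < pi / 2 ->
  arcsine_pdf (sin x) * cos x = pi^-1.
Proof.
move=> /cos_gt0_pihalf cx; rewrite /arcsine_pdf -cos2sin2 sqrtr_sqr gtr0_norm//.
by rewrite invfM -mulrA mulVf ?mulr1// gt_eqF.
Qed.

Section substitution.
Variable g : R -> R.
Hypothesis g_cont : continuous g.

(** These segments stay inside the open interval, where the density is continuous, so the
    substitution rule for increasing functions applies. *)
Let arcsine_integral_sin_cc n :
  (\int[mu]_(s in `[sin (- phi n), sin (phi n)]) (g s * arcsine_pdf s)%:E =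
   \int[mu]_(x in `[(- phi n)%R, phi n]) (g (sin x) / pi)%:E)%E.
Proof.
have sin' : derive1 (@sin R) = cos.
  by apply/funext => x; rewrite derive1E derive_val.
have /andP[phi0 phi1] := phi_bound n.
rewrite (@integration_by_substitution_increasing R sin
  (fun s => g s * arcsine_pdf s)); first last.
- apply: continuous_in_subspaceT => s; rewrite inE /= in_itv/= => /andP[s1 s2].
  have s1' : -1 < s < 1.
    have phipi : - (pi / 2) < phi n < pi / 2.
      by rewrite phi1 andbT (lt_le_trans _ phi0)// oppr_lt0 divr_gt0// pi_gt0.
    have /andP[h1 h2] := sin_itv_bound _ phipi.
    by rewrite (le_lt_trans s2 h2) (lt_le_trans _ s1)// sinN ltrN2.
  by apply: cvgM; [exact: g_cont|exact: continuous_arcsine_pdf].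
- split.
  + by move=> x _; exact: ex_derive.
  + exact/cvg_at_right_filter/continuous_sin.
  + exact/cvg_at_left_filter/continuous_sin.
- by rewrite sin'; apply: cvgP; exact/cvg_at_left_filter/continuous_cos.
- by rewrite sin'; apply: cvgP; exact/cvg_at_right_filter/continuous_cos.
- by rewrite sin' => x _; exact: continuous_cos.
- move=> x y /phi_itv xI /phi_itv yI xy.
  by rewrite ltr_sin//; apply: subset_itv_oo_cc.
- by rewrite ge0_cp.
apply: eq_integral => x; rewrite inE/= => /phi_itv; rewrite in_itv/= => xI.
by rewrite sin' !fctE -mulrA arcsine_pdf_sin.
Qed.

(** Monotone convergence along the exhausting segments carries the substitution to the open
    intervals; this is where the sign of [g] enters. *)
Lemma arcsine_integral_sin : (forall s, -1 < s < 1 -> 0 <= g s) ->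
  (\int[mu]_(s in `](-1)%R, 1%R[) (g s * arcsine_pdf s)%:E =
   \int[mu]_(x in `](- (pi / 2))%R, (pi / 2)%R[) (g (sin x) / pi)%:E)%E.
Proof.
move=> g0.
have pi0 : 0 < pi / 2 :> R by rewrite divr_gt0// pi_gt0.
pose S n : set R := `[sin (- phi n), sin (phi n)]%classic.
pose T n : set R := `[(- phi n)%R, phi n]%classic.
have sphi_homo m n : (m <= n)%N -> sin (phi m) <= sin (phi n).
  move=> mn; have /andP[a b] := phi_bound m; have /andP[c d] := phi_bound n.
  rewrite leNgt ltr_sin ?in_itv/= ?(ltW b) ?(ltW d) ?andbT -?leNgt ?phi_homo//;
    lra.
have asin_sin (x : R) :
    -1 < x < 1 -> - (pi / 2) < asin x < pi / 2 /\ sin (asin x) = x.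
  move=> /andP[x1 x2]; rewrite asin_gtNpi2 ?x1 ?ltW//= asin_ltpi2 ?x2 ?ltW//.
  by rewrite asinK// in_itv/= !ltW.
have TE : \bigcup_n T n = `](- (pi / 2)), (pi / 2)[%classic.
  apply/seteqP; split=> [x [n _]|x /= /[!in_itv] /phi_exhaust[n xn]].
    exact: phi_itv.
  by exists n => //=; rewrite in_itv.
have SE : \bigcup_n S n = `](-1), 1[%classic.
  apply/seteqP; split=> [s [n _]|s /= /[!in_itv] s1].
    rewrite /S /= !in_itv/= => /andP[s1 s2]; have /andP[p1 p2] := phi_bound n.
    have /sin_itv_bound/andP[h1 h2] : - (pi / 2) < phi n < pi / 2 by lra.
    by rewrite (le_lt_trans s2 h2) (lt_le_trans _ s1)// sinN ltrN2.
  (* [asin] pulls s back to a point of some [T n], and monotonicity of sin sends that segment onto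
     [S n]. *)
  have [xI <-] := asin_sin s s1; set x := asin s in xI *.
  have [n xn] := phi_exhaust _ xI.
  exists n => //; rewrite /S /= in_itv/=.
  have nI : - (pi / 2) < phi n < pi / 2 by have := phi_bound n; lra.
  rewrite !leNgt !ltr_sin -?leNgt ?xn// in_itv/=; lra.
rewrite -SE -TE.
have SA : (\int[mu]_(s in S n) (g s * arcsine_pdf s)%:E)%E @[n --> \oo] -->
    (\int[mu]_(s in \bigcup_n S n) (g s * arcsine_pdf s)%:E)%E.
  apply: ge0_nondecreasing_set_cvg_integral => //.
  - move=> m n mn; apply/subsetPset => s; rewrite /S /= !in_itv/= !sinN.
    by move=> /andP[s1 s2]; have := sphi_homo m n mn; lra.
  - by move=> n; apply: measurable_itv.
  - move=> n; apply/measurable_EFinP; apply: subspace_continuous_measurable_fun.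
      exact: measurable_itv.
    apply: continuous_in_subspaceT => s /set_mem Sns; have s1 : -1 < s < 1.
      suff : s \in `](-1), 1[%R by rewrite in_itv.
      by have : (\bigcup_n S n) s by [exists n]; rewrite SE.
    by apply: cvgM; [exact: g_cont|exact: continuous_arcsine_pdf].
  - move=> n s Sns; rewrite lee_fin mulr_ge0 ?arcsine_pdf_ge0// g0//.
    suff : s \in `](-1), 1[%R by rewrite in_itv.
    by have : (\bigcup_n S n) s by [exists n]; rewrite SE.
have TA : (\int[mu]_(x in T n) (g (sin x) / pi)%:E)%E @[n --> \oo] -->
    (\int[mu]_(x in \bigcup_n T n) (g (sin x) / pi)%:E)%E.
  apply: ge0_nondecreasing_set_cvg_integral => //.
  - move=> m n mn; apply/subsetPset => s; rewrite /T /= !in_itv/=.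
    by move=> /andP[s1 s2]; have := phi_homo m n mn; lra.
  - by move=> n; exact: measurable_itv.
  - move=> n; apply/measurable_EFinP; apply: measurable_funTS.
    apply: continuous_measurable_fun => x.
    apply: cvgMr_tmp; apply: continuous_comp; last exact: g_cont.
    exact: continuous_sin.
  - move=> n x Tnx; rewrite lee_fin divr_ge0 ?pi_ge0// g0// sin_itv_bound//.
    suff : x \in `](- (pi / 2)), (pi / 2)[%R by rewrite in_itv.
    by have : (\bigcup_n T n) x by [exists n]; rewrite TE.
rewrite -(cvg_lim _ SA)// -(cvg_lim _ TA)//; apply: congr_lim.
by apply/funext => n; exact: arcsine_integral_sin_cc.
Qed.

End substitution.

End arcsine_moments.

(** * Moments of the arcsine law *)

(** The j-th moment of the arcsine law, equivalently the mean of sin^j on (-pi/2, pi/2). *)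
Definition arcsine_moment {R : realType} (j : nat) : R :=
  if odd j then 0 else 'C(j, j./2)%:R / 2 ^+ j.

(** The Wallis recurrence, the same that integration by parts of sin^(j+2) produces. *)
Lemma arcsine_momentSS {R : realType} j :
  arcsine_moment j.+2 = j.+1%:R / j.+2%:R * arcsine_moment j :> R.
Proof.
rewrite /arcsine_moment /= negbK; have [|even_j] := boolP (odd j).
  by rewrite mulr0.
have := odd_double_half j; rewrite (negbTE even_j) add0n => jE.
move: (j./2) jE => i <- {j even_j}.
(* The ratio of consecutive central binomial coefficients, from two absorption identities. *)
have e : ('C(i.*2.+2, i.+1) * i.*2.+2 = 4 * (i.*2.+1 * 'C(i.*2, i)))%N.
  have := mul_bin_diag i.*2.+2 i; have := mul_bin_down i.*2.+1 i.
  have -> : (i.*2.+1 - i = i.+1)%N by lia.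
  rewrite /= -addnn; nia.
have /eqP := e; rewrite -(eqr_nat R) !natrM => /eqP /(canRL (mulfK _)) ->.
  by rewrite !exprS; field; rewrite expf_neq0 ?pnatr_eq0//= -!nat1r.
by rewrite pnatr_eq0.
Qed.

Section sine_power_primitive.
Context {R : realType}.

(** The antiderivative of sin^j that integration by parts gives, reducing j in steps of two. *)
Fixpoint sin_primitive (j : nat) (x : R) : R :=
  match j with
  | 0 => x
  | 1 => - cos x
  | j'.+2 => (j'.+1%:R * sin_primitive j' x - sin x ^+ j'.+1 * cos x) / j'.+2%:R
  end.

Lemma is_derive_sin_primitive j (x : R) :
  is_derive x 1 (sin_primitive j) (sin x ^+ j).
Proof.
elim/ltn_ind: j => -[_|[_|j IH]].
- exact: is_derive_id.
- by rewrite -[sin x]opprK; exact: is_deriveN.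
- have IHj := IH j (ltnW (ltnSn _)).
  have -> : sin_primitive j.+2 = j.+2%:R^-1 *:
      (j.+1%:R *: sin_primitive j - (@sin R) ^+ j.+1 * (@cos R)).
    by apply/funext => y /=; rewrite !fctE /= /GRing.scale /= mulrC.
  apply: is_derive_eq.
  rewrite !fctE /GRing.scale /= [cos x * _]mulrCA -expr2 cos2sin2 !exprS.
  by field; rewrite -!nat1r.
Qed.

(** cos vanishes at both endpoints, so the boundary term drops and the difference obeys the same
    two-step recurrence as the moments. *)
Lemma sin_primitive_diff j :
  sin_primitive j (pi / 2) - sin_primitive j (- (pi / 2)) =
  pi * arcsine_moment j.
Proof.
elim/ltn_ind: j => -[_|[_|j IH]].
- by rewrite /= /arcsine_moment /= bin0 expr0 divr1 mulr1 opprK -splitr.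
- by rewrite /= cosN subrr /arcsine_moment mulr0.
- have IHj := IH j (ltnW (ltnSn _)).
  transitivity (j.+1%:R / j.+2%:R *
      (sin_primitive j (pi / 2) - sin_primitive j (- (pi / 2)))).
    by rewrite /= cosN cos_pihalf; ring.
  by rewrite IHj arcsine_momentSS; ring.
Qed.

Local Notation mu := (@lebesgue_measure R).

(** Nonnegativity is asked of the whole sum because single terms may change sign. The substitution
    leaves powers of sin, which [sin_primitive] integrates. *)
Lemma arcsine_integral_sum N (c : nat -> R) :
  (forall s, -1 < s < 1 -> 0 <= \sum_(l < N) c l * s ^+ l) ->
  (\int[mu]_(s in `](-1)%R, 1%R[)
     ((\sum_(l < N) c l * s ^+ l) * arcsine_pdf s)%:E =
   (\sum_(l < N) c l * arcsine_moment l)%:E)%E.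
Proof.
move=> c0; have pi0 : 0 < pi :> R by exact: pi_gt0.
have cont : continuous (fun s : R => \sum_(l < N) c l * s ^+ l).
  rewrite (_ : (fun s => _) = horner (\poly_(l < N) c l)).
    exact: continuous_horner.
  by apply/funext => s; rewrite horner_poly.
rewrite (arcsine_integral_sin _ cont c0).
pose F : R -> R := \sum_(l < N) (c l / pi *: sin_primitive l).
have dF (x : R) : is_derive x 1 F (\sum_(l < N) (c l / pi *: sin x ^+ l)).
  apply: is_derive_sum => l; apply: is_deriveZ.
  exact: is_derive_sin_primitive.
have fE (x : R) : (\sum_(l < N) c l * sin x ^+ l) / pi =
    \sum_(l < N) (c l / pi *: sin x ^+ l).
  by rewrite mulr_suml; apply: eq_bigr => l _; rewrite /GRing.scale /=; ring.
have fcont : continuous (fun x => (\sum_(l < N) c l * sin x ^+ l) / pi).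
  move=> x; apply: cvgMr_tmp.
  apply: (@continuous_comp _ _ _ sin (fun s => \sum_(l < N) c l * s ^+ l));
    last exact: cont.
  exact: continuous_sin.
(* Adding the endpoints does not change the integral and gives the closed segment of the fundamental
   theorem of calculus. *)
rewrite -(@integral_itv_bndoo _ _ _ _ true false); last first.
  apply/measurable_EFinP; apply: measurable_funTS.
  exact: continuous_measurable_fun.
rewrite (@continuous_FTC2 _ _ F); first last.
- by move=> x _; rewrite derive1E derive_val fE.
- have cF x : {for x, continuous F}.
    by apply/differentiable_continuous/derivable1_diffP; exact: ex_derive.
  split.
  + by move=> x _; exact: ex_derive.
  + exact/cvg_at_right_filter/cF.
  + exact/cvg_at_left_filter/cF.
- exact/continuous_subspaceT.
- lra.
rewrite -EFinB /F !fct_sumE -sumrB; congr EFin; apply: eq_bigr => l _.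
rewrite !fctE -scalerBr sin_primitive_diff /GRing.scale /= mulrA.
by rewrite divfK ?gt_eqF.
Qed.

End sine_power_primitive.

(** * The inner integral and its average over u *)

Lemma arcsine_moment_identity {R : realType} (u h : R) k : 0 <= u -> 0 <= h ->
  \sum_(l < k.+1) 'C(k, l)%:R * (u + h) ^+ (k - l) *
     (2 * Num.sqrt (u * h)) ^+ l * arcsine_moment l =
  \sum_(i < k.+1) 'C(k, i)%:R ^+ 2 * h ^+ (k - i) * u ^+ i.
Proof.
move=> u0 h0.
have coefXD (c : R) n j : (j <= n)%N ->
    (('X + c%:P) ^+ n)`_j = 'C(n, j)%:R * c ^+ (n - j).
  move=> jn; rewrite addrC exprDn coef_sum.
  rewrite (bigD1 (inord j))//= inordK ?ltnS// big1 ?addr0.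
    by rewrite coefMn -polyC_exp coefCM coefXn eqxx mulr1 mulr_natl.
  move=> i ij; rewrite coefMn -polyC_exp coefCM coefXn.
  case: eqP => [ji|_]; last by rewrite mulr0 mul0rn.
  by move: ij; rewrite ji inord_val eqxx.
(* The right-hand sum is the Cauchy product of the two binomials. *)
transitivity ((('X + h%:P) ^+ k * ('X + u%:P) ^+ k)`_k); last first.
  rewrite coefM; apply: eq_bigr => i _.
  have ik : (i <= k)%N by rewrite -ltnS.
  by rewrite !coefXD ?leq_subr// bin_sub// subKn//; ring.
rewrite -exprMn (_ : _ * _ = (u + h)%:P * 'X + ('X ^+ 2 + (u * h)%:P));
  last first.
  by rewrite polyCD polyCM; ring.
rewrite exprDn coef_sum; apply: eq_bigr => l _.
have lk : (l <= k)%N by rewrite -ltnS.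
rewrite coefMn [in RHS]exprMn -polyC_exp -[in RHS]mulrA coefCM.
rewrite -[RHS]mulr_natl -!mulrA; congr (_ * (_ * _)).
rewrite coefXnM ltnNge leq_subr /= subKn//.
(* What remains is the coefficient of ['X^l] in (X^2 + u h)^l: the middle term if l is even, 0
   otherwise. The factor 2^l cancels the denominator of the moment. *)
rewrite addrC exprDn coef_sum /arcsine_moment.
have term (j : 'I_l.+1) :
    ((u * h)%:P ^+ (l - j) * 'X^2 ^+ j *+ 'C(l, j))`_l =
    (val l == j.*2)%:R * ('C(l, j)%:R * (u * h) ^+ (l - j)).
  rewrite coefMn -polyC_exp coefCM -exprM coefXn mul2n -mulr_natl; ring.
rewrite (eq_bigr _ (fun j _ => term j)).
have [odd_l|even_l] := boolP (odd l).
  rewrite mulr0 big1// => j _; case: eqP => [lj|_]; last by rewrite mul0r.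
  by have := odd_double j; rewrite -lj odd_l.
have := odd_double_half l; rewrite (negbTE even_l) add0n => lE.
have hl : (l./2 < l.+1)%N by lia.
rewrite (bigD1 (Ordinal hl))//= lE eqxx big1 ?addr0.
  have -> : (l - l./2 = l./2)%N by lia.
  rewrite mul1r exprMn; have -> : Num.sqrt (u * h) ^+ l = (u * h) ^+ l./2.
    by rewrite -[in LHS]lE -mul2n exprM sqr_sqrtr// mulr_ge0.
  by field; rewrite expf_neq0.
move=> j jl; case: eqP => [lj|_]; last by rewrite mul0r.
by move: jl; have := doubleK j; rewrite -lj -val_eqE /= => ->; rewrite eqxx.
Qed.

(** For s > -1 the expression is at least (sqrt u - sqrt h)^2. *)
Lemma addr_2sqrt_ge0 {R : realType} (u h s : R) :
  0 <= u -> 0 <= h -> -1 < s < 1 -> 0 <= u + 2 * Num.sqrt (u * h) * s + h.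
Proof.
move=> u0 h0 /andP[s1 s2]; rewrite sqrtrM//.
set x := Num.sqrt u; set y := Num.sqrt h.
have xy0 : 0 <= x * y by rewrite mulr_ge0 ?sqrtr_ge0.
rewrite -(sqr_sqrtr u0) -(sqr_sqrtr h0) -/x -/y.
have := sqr_ge0 (x - y); nra.
Qed.

Lemma arcsine_integral_pow {R : realType} (u h : R) k : 0 <= u -> 0 <= h ->
  (\int[lebesgue_measure]_(s in `](-1)%R, 1%R[)
     ((u + 2 * Num.sqrt (u * h) * s + h) ^+ k * arcsine_pdf s)%:E =
   (\sum_(i < k.+1) 'C(k, i)%:R ^+ 2 * h ^+ (k - i) * u ^+ i)%:E)%E.
Proof.
move=> u0 h0; rewrite -arcsine_moment_identity//.
pose c l := 'C(k, l)%:R * (u + h) ^+ (k - l) * (2 * Num.sqrt (u * h)) ^+ l.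
have gE (s : R) : (u + 2 * Num.sqrt (u * h) * s + h) ^+ k =
    \sum_(l < k.+1) c l * s ^+ l.
  rewrite addrAC exprDn; apply: eq_bigr => l _.
  by rewrite -mulr_natl exprMn /c !mulrA.
rewrite -(arcsine_integral_sum k.+1 c).
  by apply: eq_integral => s _; rewrite gE.
by move=> s s1; rewrite -gE exprn_ge0// addr_2sqrt_ge0.
Qed.

Lemma integral01_sum_pow {R : realType} N (c : nat -> R) :
  (\int[lebesgue_measure]_(u in `[0%R, 1%R]) (\sum_(i < N) c i * u ^+ i)%:E =
   (\sum_(i < N) c i / i.+1%:R)%:E)%E.
Proof.
have pE : (fun u : R => \sum_(i < N) c i * u ^+ i) = horner (\poly_(i < N) c i).
  by apply/funext => u; rewrite horner_poly.
pose F : R -> R := \sum_(i < N) (c i / i.+1%:R *: ((@id R) ^+ i.+1)).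
have dF (x : R) : is_derive x 1 F (\sum_(i < N) c i * x ^+ i).
  rewrite [X in is_derive _ _ _ X](_ : _ =
      \sum_(i < N) c i / i.+1%:R *: ((i.+1%:R * x ^+ i) *: (1 : R))).
    by apply: is_derive_sum => i; apply: is_deriveZ; exact: is_deriveX.
  by apply: eq_bigr => i _; rewrite /GRing.scale /=; field; rewrite nat1r.
have cF x : {for x, continuous F}.
  by apply/differentiable_continuous/derivable1_diffP; exact: ex_derive.
rewrite (@continuous_FTC2 _ _ F); first last.
- by move=> x _; rewrite derive1E derive_val.
- split.
  + by move=> x _; exact: ex_derive.
  + exact/cvg_at_right_filter/cF.
  + exact/cvg_at_left_filter/cF.
- by apply: continuous_subspaceT; rewrite pE; exact: continuous_horner.
- exact: ltr01.
rewrite -EFinB /F !fct_sumE -sumrB; congr EFin; apply: eq_bigr => l _.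
by rewrite !fctE expr1n expr0n /= scaler0 subr0 /GRing.scale /= mulr1.
Qed.

(** * Expectations under independent uniform and arcsine variables *)

Import HBNNSimple.

(** The standard extension: indicators by hypothesis, nonnegative simple functions by linearity,
    nonnegative measurable functions by monotone convergence. *)
Lemma integral_density {d : measure_display} {T : measurableType d}
    {R : realType} (mu nu : {measure set T -> \bar R}) (D : set T)
    (p : T -> R) (f : T -> \bar R) :
  measurable D -> measurable_fun D p -> (forall x, D x -> 0 <= p x) ->
  (forall A, measurable A -> nu A = \int[mu]_(x in A `&` D) (p x)%:E)%E ->
  measurable_fun setT f -> (forall x, 0 <= f x)%E ->
  (\int[nu]_x f x = \int[mu]_(x in D) (f x * (p x)%:E))%E.
Proof.
move=> mD mp p0 nuE mf f0; have mpE : measurable_fun D (EFin \o p).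
  exact/measurable_EFinP.
have intE (A : set T) : measurable A ->
    (\int[nu]_x (\1_A x)%:E = \int[mu]_(x in D) ((\1_A x)%:E * (p x)%:E))%E.
  move=> mA; rewrite integral_indic// setIT nuE// setIC integral_mkcondr.
  apply: eq_integral => x _; rewrite patchE indicE.
  by case: ifPn => xA; rewrite ?mul1e ?mul0e.
have fin_sumE (g : {nnsfun T >-> R}) :
    (\int[nu]_x (g x)%:E = \int[mu]_(x in D) ((g x)%:E * (p x)%:E))%E.
  under [LHS]eq_integral do rewrite fimfunE -fsumEFin//.
  rewrite [LHS]ge0_integral_fsum//; last 2 first.
    by move=> r; exact/measurable_EFinP/measurableT_comp.
    by move=> r x _; rewrite EFinM nnfun_muleindic_ge0.
  (* The density is distributed over the level sets of [g], so that each summand reduces to an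
     indicator. *)
  have -> : (\int[mu]_(x in D) ((g x)%:E * (p x)%:E) = \int[mu]_(x in D)
      \sum_(r \in range g) (r%:E * ((\1_(g @^-1` [set r]) x)%:E * (p x)%:E)))%E.
    apply: eq_integral => x /set_mem Dx.
    rewrite fimfunE -fsumEFin// ge0_mule_fsuml; last first.
      by move=> r; rewrite EFinM nnfun_muleindic_ge0.
    by apply: eq_fsbigr => r _; rewrite EFinM muleA.
  rewrite ge0_integral_fsum//; last 2 first.
    move=> r; apply: emeasurable_funM => //; apply: emeasurable_funM => //.
    exact/measurable_EFinP/measurable_funTS.
    move=> r x Dx; rewrite muleA mule_ge0 ?lee_fin ?p0// -lee_fin EFinM.
    by rewrite nnfun_muleindic_ge0.
  apply: eq_fsbigr => r /set_mem[x _ <-].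
  rewrite integralZl_indic_nnsfun// intE// ge0_integralZl//.
  - apply: emeasurable_funM => //.
    exact/measurable_EFinP/measurable_funTS.
  - by move=> y Dy; rewrite mule_ge0 ?lee_fin ?p0.
  - by rewrite lee_fin.
pose f_ := nnsfun_approx measurableT mf.
transitivity (limn (fun n => \int[nu]_x (f_ n x)%:E))%E.
  rewrite -monotone_convergence//=.
  - apply: eq_integral => x _; apply/esym/cvg_lim => //.
    exact: cvg_nnsfun_approx.
  - by move=> n; exact/measurable_EFinP/measurable_funTS.
  - by move=> n x _; rewrite lee_fin.
  - by move=> x _ m n mn; rewrite lee_fin; exact/lefP/nd_nnsfun_approx.
under eq_fun do rewrite fin_sumE.
rewrite -monotone_convergence//=.
- apply: eq_integral => x /set_mem Dx; apply/cvg_lim => //.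
  by apply: cvgeZr => //; exact: cvg_nnsfun_approx.
- move=> n; apply: emeasurable_funM => //.
  exact/measurable_EFinP/measurable_funTS.
- by move=> n x Dx; rewrite mule_ge0 ?lee_fin ?p0// lee_fin.
- move=> x Dx m n mn; apply: lee_wpmul2r; first by rewrite lee_fin p0.
  by rewrite lee_fin; exact/lefP/nd_nnsfun_approx.
Qed.

(** Independence makes the joint law agree with the product law on rectangles, hence everywhere;
    Tonelli then iterates the integral. *)
Lemma ge0_expectation_independent {d d1 d2 : measure_display}
    {T : measurableType d} {T1 : measurableType d1} {T2 : measurableType d2}
    {R : realType} (P : probability T R) (X : {RV P >-> T1}) (Y : {RV P >-> T2})
    (g : T1 * T2 -> \bar R) :
  (forall A B, measurable A -> measurable B ->
    P (X @^-1` A `&` Y @^-1` B) = P (X @^-1` A) * P (Y @^-1` B))%E ->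
  measurable_fun setT g -> (forall z, 0 <= g z)%E ->
  (\int[P]_w g (X w, Y w) =
   \int[distribution P X]_x \int[distribution P Y]_y g (x, y))%E.
Proof.
move=> XY mg g0.
have mXY : measurable_fun setT (fun w => (X w, Y w)).
  exact: measurable_fun_pair.
pose Z : {mfun T >-> (T1 * T2)%type} := HB.pack (fun w => (X w, Y w))
  (isMeasurableFun.Build _ _ _ _ _ mXY).
have -> : (\int[P]_w g (X w, Y w) = \int[distribution P Z]_z g z)%E.
  by rewrite ge0_integral_distribution.
rewrite -[RHS]fubini_tonelli1//; apply: eq_measure_integral => A mA _.
by apply/esym/product_measure_unique => // B C mB mC; exact: XY.
Qed.

Section expectation_uniform_arcsine.
Context {d : measure_display} {T : measurableType d} {R : realType}.
Variables (P : probability T R) (U xi : {RV P >-> R}).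
Hypotheses (unifU : uniform01_distributed U) (arcxi : arcsine_distributed xi)
  (indep : independent_RV2 U xi).
Local Notation mu := (@lebesgue_measure R).

(* [lebesgue_measure] lives on [measurableTypeR R], which has the sigma-algebra
   of [R] but is another structure, so the variables are retyped. *)
Let mR := measurableTypeR R.

Let mU : measurable_fun setT (U : T -> mR).
Proof. exact: (@measurable_funPT _ _ _ _ U). Qed.

Let mxi : measurable_fun setT (xi : T -> mR).
Proof. exact: (@measurable_funPT _ _ _ _ xi). Qed.

Let U' : {RV P >-> mR} :=
  HB.pack (U : T -> mR) (isMeasurableFun.Build _ _ _ _ _ mU).
Let xi' : {RV P >-> mR} :=
  HB.pack (xi : T -> mR) (isMeasurableFun.Build _ _ _ _ _ mxi).

Let D : set (mR * mR) := `[0%R, 1%R] `*` `](-1)%R, 1%R[.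

(** The mass of the complement of each interval is an integral over the empty set. *)
Let ae_D : {ae P, forall w, D (U w, xi w)}.
Proof.
have negl (X : {RV P >-> R}) (A : set R) : measurable A ->
    distribution P X (~` A) = 0%E -> {ae P, forall w, A (X w)}.
  move=> mA XA; exists (X @^-1` (~` A)); split => //.
  by apply: measurable_funPTI => //; exact: measurableC.
have aeU : {ae P, forall w, `[0%R, 1%R]%classic (U w)}.
  apply: negl => //; rewrite unifU; last exact: measurableC.
  by rewrite /uniform_prob integral_uniform_pdf setICl integral_set0.
have aexi : {ae P, forall w, `](-1)%R, 1%R[%classic (xi w)}.
  apply: negl => //; rewrite arcxi; last exact: measurableC.
  by rewrite setICl integral_set0.
by apply: filterS2 aeU aexi => w.
Qed.

Lemma expectation_uniform_arcsine (g : R -> R -> R) :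
  measurable_fun setT (fun z : mR * mR => g z.1 z.2) ->
  (forall u s, 0 <= u <= 1 -> -1 < s < 1 -> 0 <= g u s) ->
  ('E_P[fun w => g (U w) (xi w)] =
   \int[mu]_(u in `[0%R, 1%R]) \int[mu]_(s in `](-1)%R, 1%R[)
     (g u s * arcsine_pdf s)%:E)%E.
Proof.
move=> mg g0.
have mD : measurable D by apply: measurableX; exact: measurable_itv.
(* The integrand need not be nonnegative off the support of the joint law. *)
pose G := (fun z : mR * mR => (g z.1 z.2)%:E) \_ D.
have mG : measurable_fun setT G.
  by apply/(measurable_restrictT _ mD)/measurable_funTS/measurable_EFinP.
have G0 z : (0 <= G z)%E.
  apply: erestrict_ge0 => {}z [/=]; rewrite !in_itv/= => z1 z2.
  by rewrite lee_fin g0.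
have mUxi : measurable_fun setT (fun w => (U' w, xi' w)).
  exact: measurable_fun_pair.
(* The pair almost surely lies in [D], so the truncation keeps the expectation. *)
transitivity (\int[P]_w G (U' w, xi' w))%E.
  rewrite unlock; apply: ae_eq_integral => //.
  - by apply/measurable_EFinP; exact: (measurableT_comp mg mUxi).
  - exact: (measurableT_comp mG mUxi).
  - by apply: filterS ae_D => w Dw _; rewrite /G patchE mem_set.
rewrite (ge0_expectation_independent P U' xi' G)//.
(* The laws are replaced from the outside in: first that of [U], then that of [xi] by its
   density. *)
transitivity (\int[uniform_prob (@ltr01 R)]_u
    \int[distribution P xi']_s G (u, s))%E.
  by apply: eq_measure_integral => A mA _; exact: unifU.
rewrite integral_uniform//; last 2 first.
- exact: (measurable_fun_fubini_tonelli_F (m2 := distribution P xi')).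
- by move=> u; apply: integral_ge0.
rewrite subr0 invr1 mul1e; apply: eq_integral => u /set_mem Du.
pose I : set mR := `](-1)%R, 1%R[%classic.
have mar : measurable_fun I (@arcsine_pdf R : mR -> R).
  apply: open_continuous_measurable_fun => [|s /set_mem]; first exact: itv_open.
  by rewrite /I /= in_itv/= => s1; exact: continuous_arcsine_pdf.
rewrite (integral_density mu _ I (@arcsine_pdf R))//.
- apply: eq_integral => s Ds; rewrite /G patchE mem_set//.
  by split => //; exact: set_mem.
- exact: measurable_itv.
- by move=> s _; exact: arcsine_pdf_ge0.
- exact: measurable_fun_pair2.
Qed.

End expectation_uniform_arcsine.

Theorem corollary9 (R : realType) (theta h : R) (k : nat) :
  0 < theta -> 0 < h ->
  [/\ poissonised_charlier_factorial_moment theta k h^-1 \is a fin_num,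
      (\int[lebesgue_measure]_(u in `[0%R, 1%R])
         \int[lebesgue_measure]_(s in `](-1)%R, 1%R[)
           ((u + 2 * Num.sqrt (u * h) * s + h) ^+ k * arcsine_pdf s)%:E =
       poissonised_charlier_factorial_moment theta k h^-1
         / ((theta / h) ^+ k)%:E)%E
    & forall (d : measure_display) (T : measurableType d)
        (P : probability T R) (U xi : {RV P >-> R}),
        uniform01_distributed U -> arcsine_distributed xi ->
        independent_RV2 U xi ->
        ('E_P[(fun w => (U w + 2 * Num.sqrt (U w * h) * xi w + h) ^+ k)%R]
         = poissonised_charlier_factorial_moment theta k h^-1
             / ((theta / h) ^+ k)%:E)%E].
Proof.
move=> theta0 h0.
have momE : (\int[lebesgue_measure]_(u in `[0%R, 1%R])
    \int[lebesgue_measure]_(s in `](-1)%R, 1%R[)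
      ((u + 2 * Num.sqrt (u * h) * s + h) ^+ k * arcsine_pdf s)%:E =
    poissonised_charlier_factorial_moment theta k h^-1
      / ((theta / h) ^+ k)%:E)%E.
  have th0 : theta / h != 0 by rewrite gt_eqF// divr_gt0.
  rewrite poissonised_charlier_factorial_momentE ?invr_gt0//.
  (* Inversion in the extended reals branches at 0, which (theta / h)^k avoids. *)
  rewrite inver expf_eq0 (negbTE th0) andbF -EFinM.
  transitivity (\int[lebesgue_measure]_(u in `[0%R, 1%R])
      (\sum_(i < k.+1) ('C(k, i)%:R ^+ 2 * h ^+ (k - i)) * u ^+ i)%:E)%E.
    apply: eq_integral => u /set_mem /=; rewrite in_itv/= => /andP[u0 _].
    by rewrite arcsine_integral_pow// ltW.
  rewrite (integral01_sum_pow k.+1 (fun i => 'C(k, i)%:R ^+ 2 * h ^+ (k - i))).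
  rewrite mulr_suml; congr EFin; apply: eq_bigr => i _.
  have ik : (i <= k)%N by rewrite -ltnS.
  (* With this splitting theta^(k - i) and (theta / h)^i cancel in each term, leaving h^(k - i) / (i
     + 1). *)
  have -> : (theta / h) ^+ k =
      theta ^+ (k - i) / h ^+ (k - i) * (theta / h) ^+ i.
    by rewrite -expr_div_n -exprD subnK.
  rewrite (mulrC h^-1); set x := (theta / h) ^+ i.
  have x0 : x != 0 by rewrite expf_neq0.
  have A0 : theta ^+ (k - i) != 0 by rewrite expf_neq0// gt_eqF.
  have B0 : h ^+ (k - i) != 0 by rewrite expf_neq0// gt_eqF.
  by field; rewrite x0 A0 B0 nat1r pnatr_eq0.
split => //.
  by rewrite poissonised_charlier_factorial_momentE ?invr_gt0.
move=> d T P U xi unifU arcxi indep; rewrite -momE.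
apply: (expectation_uniform_arcsine P U xi unifU arcxi indep
  (fun u s => (u + 2 * Num.sqrt (u * h) * s + h) ^+ k)).
  apply: measurable_funX; apply: measurable_funD => //.
  apply: measurable_funD => //; apply: measurable_funM => //.
  apply: measurable_funM => //.
  apply: (measurableT_comp (f := @Num.sqrt R)).
    by apply: continuous_measurable_fun; exact: sqrt_continuous.
  by apply: measurable_funM.
by move=> u s /andP[u0 u1] s1; rewrite exprn_ge0// addr_2sqrt_ge0// ltW.
Qed.
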